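(* Suppose assumptions A1), A2), A3), A4), A5) and Ã6) (stated in the context) hold. Then: (a) the value function $V$ is well defined on $[0,\infty)\times\mathbb{R}^n$; (b) the value function $V$ is locally Lipschitz continuous in its domain of definition $[0,\infty)\times\mathbb{R}^n$.
   Context: Data: $l:[0,\infty)\times\mathbb{R}^n\times\mathbb{R}^m\to\mathbb{R}$ and $f:[0,\infty)\times\mathbb{R}^n\times\mathbb{R}^m\to\mathbb{R}^n$ are given functions, $\Omega\subset\mathbb{R}^m$ is a nonempty set (admissible control actions), and $\delta>0$ is the discount rate. For $(\tau,z)\in[0,\infty)\times\mathbb{R}^n$ let $U_{ad}[\tau,\infty):=\{w\in L^1_{loc}([\tau,\infty);\mathbb{R}^m) : w(t)\in\Omega \text{ a.e. in } [\tau,\infty)\}$. An admissible process for the initial condition $(\tau,z)$ is a pair $(x,u)$ with $u\in U_{ad}[\tau,\infty)$ and $x$ a (locally) absolutely continuous function on $[\tau,\infty)$ with $x(t)=z+\int_\tau^t f(s,x(s),u(s))\,ds$ for $t\ge\tau$. Its cost is $J(u;\tau,z):=\int_\tau^\infty e^{-\delta t}l(t,x(t),u(t))\,dt$. Let $\mathcal{D}_{\tau,z;\infty}$ be the set of admissible processes $(x,u)$ for $(\tau,z)$ with $J(u;\tau,z)<\infty$. Value function: $V:[0,\infty)\times\mathbb{R}^n\to\mathbb{R}$, $V(\tau,z):=\inf\{J(u;\tau,z) : (x,u)\in\mathcal{D}_{\tau,z;\infty}\}$. Assumptions: A1) There exists $K_1>0$ such that for every $t\in[0,\infty)$, $u\in\Omega$: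 $|l(t,x,u)-l(t,z,u)|+|f(t,x,u)-f(t,z,u)|\le K_1|x-z|$ for all $x,z\in\mathbb{R}^n$. A2) There exists $K_2>0$ such that $|l(t,x,u)|+|f(t,x,u)|\le K_2(1+|x|)$ for all $t\in[0,\infty)$, $x\in\mathbb{R}^n$, $u\in\Omega$. A3) $l$ and $f$ are continuous. A4) For all $t,x$, the set $\{(e^{-\delta t}l(t,x,v),f(t,x,v))^T : v\in\Omega\}$ is convex in $\mathbb{R}^{n+1}$. A5) $\Omega$ is compact. Ã6) The Lipschitz constant $K_1$ in A1) and $\delta$ satisfy $K_1-\delta<0$. Furthermore, given $(\tau,z)\in[0,\infty)\times\mathbb{R}^n$, there exist a neighborhood $\mathcal{V}_{\tau,z}$ of $(\tau,z)$ and a bounded set $\mathcal{S}_{\tau,z}\subset\mathbb{R}^n$ such that for every initial condition $(\tilde\tau,\tilde z)\in\mathcal{V}_{\tau,z}$, every $(x,u)\in\mathcal{D}_{\tilde\tau,\tilde z;\infty}$ satisfies $x(t)\in\mathcal{S}_{\tau,z}$ for all $t\ge\tilde\tau$. *)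

(* Defs.v *)
From HB Require Import structures.
From mathcomp Require Import all_boot all_order all_algebra.
From mathcomp Require Import all_classical all_reals all_analysis.
Set Implicit Arguments.
Unset Strict Implicit.
Unset Printing Implicit Defensive.
Import Order.TTheory GRing.Theory Num.Theory.
Import numFieldNormedType.Exports.
Local Open Scope classical_set_scope.
Local Open Scope ring_scope.

(* The library norm on row vectors is the sup norm; this is the Euclidean one. *)
Definition enorm (R : realType) (n : nat) (v : 'rV[R]_n) : R :=
  Num.sqrt (\sum_(j < n) v ord0 j ^+ 2).

(* The family (c i).1, (c i).2 lists the endpoints of finitely many
   nonoverlapping subintervals of [a, b]. *)
Definition abs_continuous_on (R : realType) (n : nat) (a b : R)
    (x : R -> 'rV[R]_n) : Prop :=
  forall e : R, 0 < e -> exists2 d : R, 0 < d &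
    forall (k : nat) (c : 'I_k -> R * R),
      (forall i, [/\ a <= (c i).1, (c i).1 <= (c i).2 & (c i).2 <= b]) ->
      trivIset setT (fun i => `](c i).1, (c i).2[%classic) ->
      \sum_(i < k) ((c i).2 - (c i).1) < d ->
      \sum_(i < k) enorm (x (c i).2 - x (c i).1) < e.

(* Functions on [tau, oo) are total functions on R; every notion below only
   looks at their values on [tau, oo). *)
Definition loc_abs_continuous (R : realType) (n : nat) (tau : R)
    (x : R -> 'rV[R]_n) : Prop :=
  forall T : R, tau <= T -> abs_continuous_on tau T x.

(* The library's [locally_integrable] requires an open domain, whereas
   local integrability on [tau, oo) includes the left endpoint. *)
Definition L1loc (R : realType) (m : nat) (tau : R) (w : R -> 'rV[R]_m) : Prop :=
  forall (T : R) (j : 'I_m), tau <= T ->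
    (@lebesgue_measure R).-integrable `[tau, T] (fun t => (w t ord0 j)%:E).

Definition admissible_control (R : realType) (m : nat) (Omega : set 'rV[R]_m)
    (tau : R) : set (R -> 'rV[R]_m) :=
  [set w | L1loc tau w /\
    {ae @lebesgue_measure R, forall t, tau <= t -> Omega (w t)}].

Definition admissible_process (R : realType) (n m : nat)
    (f : R -> 'rV[R]_n -> 'rV[R]_m -> 'rV[R]_n) (Omega : set 'rV[R]_m)
    (tau : R) (z : 'rV[R]_n) : set ((R -> 'rV[R]_n) * (R -> 'rV[R]_m)) :=
  [set p | let x := p.1 in let u := p.2 in
    [/\ admissible_control Omega tau u,
        loc_abs_continuous tau x &
        forall (t : R) (j : 'I_n), tau <= t ->
          (@lebesgue_measure R).-integrable `[tau, t]
             (fun s => (f s (x s) (u s) ord0 j)%:E) /\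
          x t ord0 j = z ord0 j +
            \int[@lebesgue_measure R]_(s in `[tau, t]) f s (x s) (u s) ord0 j]].

Definition running_cost (R : realType) (n m : nat)
    (l : R -> 'rV[R]_n -> 'rV[R]_m -> R) (delta : R)
    (p : (R -> 'rV[R]_n) * (R -> 'rV[R]_m)) (t : R) : R :=
  expR (- (delta * t)) * l t (p.1 t) (p.2 t).

(* The library integral is total and equals -oo when the positive and the
   negative part both have infinite integral; [cost_defined] excludes this
   case, the integral then being the Lebesgue integral in [-oo, +oo]. *)
Definition cost_defined (R : realType) (n m : nat)
    (l : R -> 'rV[R]_n -> 'rV[R]_m -> R) (delta tau : R)
    (p : (R -> 'rV[R]_n) * (R -> 'rV[R]_m)) : Prop :=
  measurable_fun `[tau, +oo[ (running_cost l delta p) /\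
  (\int[@lebesgue_measure R]_(t in `[tau, +oo[)
      (EFin \o running_cost l delta p)^\+ t +?
   - \int[@lebesgue_measure R]_(t in `[tau, +oo[)
      (EFin \o running_cost l delta p)^\- t)%E.

Definition cost (R : realType) (n m : nat)
    (l : R -> 'rV[R]_n -> 'rV[R]_m -> R) (delta tau : R)
    (p : (R -> 'rV[R]_n) * (R -> 'rV[R]_m)) : \bar R :=
  (\int[@lebesgue_measure R]_(t in `[tau, +oo[) (running_cost l delta p t)%:E)%E.

Definition finite_cost_process (R : realType) (n m : nat)
    (l : R -> 'rV[R]_n -> 'rV[R]_m -> R)
    (f : R -> 'rV[R]_n -> 'rV[R]_m -> 'rV[R]_n)
    (Omega : set 'rV[R]_m) (delta tau : R) (z : 'rV[R]_n) :
    set ((R -> 'rV[R]_n) * (R -> 'rV[R]_m)) :=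
  [set p | [/\ admissible_process f Omega tau z p,
               cost_defined l delta tau p &
               (cost l delta tau p < +oo)%E]].

Definition value_function (R : realType) (n m : nat)
    (l : R -> 'rV[R]_n -> 'rV[R]_m -> R)
    (f : R -> 'rV[R]_n -> 'rV[R]_m -> 'rV[R]_n)
    (Omega : set 'rV[R]_m) (delta tau : R) (z : 'rV[R]_n) : \bar R :=
  ereal_inf [set cost l delta tau p |
             p in finite_cost_process l f Omega delta tau z].

(* The value function is a real number iff it is an infimum of a nonempty set
   that is bounded below; the infimum of the empty set is +oo. *)
Definition value_well_defined (R : realType) (n m : nat)
    (l : R -> 'rV[R]_n -> 'rV[R]_m -> R)
    (f : R -> 'rV[R]_n -> 'rV[R]_m -> 'rV[R]_n)
    (Omega : set 'rV[R]_m) (delta tau : R) (z : 'rV[R]_n) : Prop :=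
  finite_cost_process l f Omega delta tau z !=set0 /\
  value_function l f Omega delta tau z \is a fin_num.

Definition locally_lipschitz_in (R : realType) (V W : normedModType R)
    (A : set V) (g : V -> W) : Prop :=
  forall p : V, A p ->
    exists2 U : set V, nbhs p U & [lipschitz g q | q in U `&` A].

Definition trajectories_locally_bounded (R : realType) (n m : nat)
    (l : R -> 'rV[R]_n -> 'rV[R]_m -> R)
    (f : R -> 'rV[R]_n -> 'rV[R]_m -> 'rV[R]_n)
    (Omega : set 'rV[R]_m) (delta : R) : Prop :=
  forall (tau : R) (z : 'rV[R]_n), 0 <= tau ->
    exists (N : set (R * 'rV[R]_n)) (S : set 'rV[R]_n),
      [/\ nbhs (tau, z) N, bounded_set S &
        forall (tau' : R) (z' : 'rV[R]_n), 0 <= tau' -> N (tau', z') ->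
        forall p, finite_cost_process l f Omega delta tau' z' p ->
        forall t : R, tau' <= t -> S (p.1 t)].

(* Main.v *)
Require Import Defs.
From HB Require Import structures.
From mathcomp Require Import all_boot all_order all_algebra.
From mathcomp Require Import all_classical all_reals all_analysis.
From mathcomp Require Import measurable_realfun ring lra.
Import Order.TTheory GRing.Theory Num.Theory.
Import numFieldNormedType.Exports.
Local Open Scope classical_set_scope.
Local Open Scope ring_scope.

(** The proof compares trajectories that start at different data but use the
    same control; nearly optimal controls are enough for this comparison.

    Since K1 < delta, a rate r = (K1 + delta) / 2 can be chosen strictly
    between the two. Along any trajectory K2 + K1 |x(t)|, which bounds both the
    dynamics and the cost density, grows at most like exp (r (t - tau))
    ([solution_growth]), and two trajectories with the same control separate at
    most at that rate ([solution_dist]). The discount exp (- delta t) beats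
    both: every admissible process has an absolutely convergent cost, bounded
    in terms of |z| alone, and the costs of the two trajectories differ by at
    most a constant times the distance of their initial data.

    For part (a) it remains to produce one process: a constant control is
    admissible, and the state equation, which is only measurable in time, has a
    global solution by Picard iteration in an exponentially weighted norm
    ([solution_exists]). The time dependence of f (t, x(t), u(t)) is measurable
    by [measurable_superposition].

    For part (b) let tau1 <= tau2. Given a process from either one of the
    initial data (tau1, z1) and (tau2, z2), its control also drives a solution
    from the other one; a control known only on [tau2, oo) is first extended by
    a constant admissible value. At time tau2 the two states are within |z1 -
    z2| + C (tau2 - tau1) of each other, and the cost accumulated on [tau1,
    tau2] is at most C (tau2 - tau1). Hence each process has a counterpart
    whose cost is larger by at most C (|z1 - z2| + tau2 - tau1)
    ([total_cost_dist]), and the infima inherit this bound ([value_dist]), with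
    C locally uniform.

    To have these estimates at every time rather than almost everywhere, a
    control is replaced by one that is measurable on the whole line with all
    its values in Omega ([process_solution], [solution_process]), and l and f
    are extended to negative times by their values at time 0. *)

Set Implicit Arguments.
Unset Strict Implicit.
Unset Printing Implicit Defensive.

(** * The Euclidean norm *)

Section euclidean_norm.
Context {R : realType} {n : nat}.
Implicit Types v w : 'rV[R]_n.

Lemma enorm_ge0 v : 0 <= enorm v.
Proof. exact: sqrtr_ge0. Qed.

Lemma enorm_sqr v : enorm v ^+ 2 = \sum_(j < n) v ord0 j ^+ 2.
Proof. by rewrite sqr_sqrtr// sumr_ge0// => j _; rewrite sqr_ge0. Qed.

Lemma coord_le_enorm v j : `|v ord0 j| <= enorm v.
Proof.
rewrite -sqrtr_sqr ler_wsqrtr// (bigD1 j)//= lerDl sumr_ge0// => i _.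
exact: sqr_ge0.
Qed.

Lemma dot_le_enorm v w :
  \sum_(j < n) v ord0 j * w ord0 j <= enorm v * enorm w.
Proof.
have [v0|v_gt0] := leP (enorm v) 0.
  rewrite big1 ?mulr_ge0 ?enorm_ge0// => j _.
  have -> : v ord0 j = 0.
    by apply/eqP; rewrite -normr_le0 (le_trans (coord_le_enorm v j)).
  by rewrite mul0r.
have [w0|w_gt0] := leP (enorm w) 0.
  rewrite big1 ?mulr_ge0 ?enorm_ge0// => j _.
  have -> : w ord0 j = 0.
    by apply/eqP; rewrite -normr_le0 (le_trans (coord_le_enorm w j)).
  by rewrite mulr0.
have ab0 : 0 < 2 * (enorm v * enorm w) by rewrite !mulr_gt0.
rewrite -(ler_pM2l ab0).
have -> : 2 * (enorm v * enorm w) * (enorm v * enorm w) =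
    \sum_(j < n) ((enorm w) ^+ 2 * v ord0 j ^+ 2 +
                  (enorm v) ^+ 2 * w ord0 j ^+ 2).
  by rewrite big_split/= -!mulr_sumr -!enorm_sqr; ring.
rewrite mulr_sumr; apply: ler_sum => j _.
by have := sqr_ge0 (enorm w * v ord0 j - enorm v * w ord0 j); nra.
Qed.

Lemma enorm_triangle v w : enorm (v + w) <= enorm v + enorm w.
Proof.
rewrite -[leRHS]ger0_norm ?addr_ge0 ?enorm_ge0// -[leLHS]ger0_norm ?enorm_ge0//.
rewrite -ler_sqr ?nnegrE ?normr_ge0// !real_normK ?num_real// enorm_sqr.
rewrite (eq_bigr (fun j => v ord0 j ^+ 2 + 2 * (v ord0 j * w ord0 j) +
    w ord0 j ^+ 2)); last by move=> j _; rewrite mxE; ring.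
rewrite !big_split/= -mulr_sumr -!enorm_sqr.
by have := dot_le_enorm v w; nra.
Qed.

Lemma enormN v : enorm (- v) = enorm v.
Proof. by congr Num.sqrt; apply: eq_bigr => j _; rewrite mxE sqrrN. Qed.

Lemma enormBC v w : enorm (v - w) = enorm (w - v).
Proof. by rewrite -opprB enormN. Qed.

Lemma enorm_leB v w : enorm v <= enorm w + enorm (v - w).
Proof. by rewrite -{1}(subrKC w v) enorm_triangle. Qed.

Lemma enorm0 : enorm (0 : 'rV[R]_n) = 0.
Proof. by rewrite /enorm big1 ?sqrtr0// => j _; rewrite mxE expr0n. Qed.

Lemma enorm_le_sum v : enorm v <= \sum_(j < n) `|v ord0 j|.
Proof.
have [v0|v_gt0] := leP (enorm v) 0; first by rewrite (le_trans v0)// sumr_ge0.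
rewrite -(ler_pM2l v_gt0) -expr2 enorm_sqr mulr_sumr ler_sum// => j _.
rewrite -[v ord0 j ^+ 2]real_normK ?num_real// expr2.
by rewrite ler_wpM2r ?normr_ge0// coord_le_enorm.
Qed.

Lemma coord_le_norm v j : `|v ord0 j| <= `|v|.
Proof.
have /mapP[i _ ->] : `|v ord0 j| \in [seq `|v x.1 x.2| | x : 'I_1 * 'I_n].
  by apply/mapP; exists (ord0, j) => //=; rewrite mem_enum.
rewrite [leRHS]/Num.norm/= mx_normrE; apply/bigmax_geP.
by right => /=; exists i.
Qed.

Lemma enorm_le_norm v : enorm v <= n%:R * `|v|.
Proof.
rewrite (le_trans (enorm_le_sum v))//.
have -> : n%:R * `|v| = \sum_(j < n) `|v|.
  by rewrite sumr_const card_ord mulr_natl.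
by apply: ler_sum => j _; exact: coord_le_norm.
Qed.

End euclidean_norm.

(** * Elementary facts on continuity and limits *)

Lemma dist_max {R : realType} (a s t : R) :
  `|Num.max a s - Num.max a t| <= `|s - t|.
Proof.
rewrite !maxEle ler_norml; have := ler_norm (s - t).
have := ler_norm (t - s); rewrite (distrC t s) => h1 h2.
by apply/andP; case: (leP a s) => ?; case: (leP a t) => ?; split; lra.
Qed.

Lemma max_continuous {R : realType} (a : R) : continuous (fun t => Num.max a t).
Proof.
move=> t; apply/cvgrPdist_le => e e0; near=> s.
apply: le_trans (dist_max _ _ _) _.
by near: s; apply: cvgr_dist_le; [exact: cvg_id|].
Unshelve. all: by end_near. Qed.

Lemma continuous_retract {X Y : topologicalType} (A : set X) (g : X -> Y)
    (rho : X -> X) : {within A, continuous g} -> continuous rho ->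
  (forall p, A (rho p)) -> continuous (g \o rho).
Proof.
move=> /subspace_continuousP cg crho Arho p.
apply: (cvg_comp _ _ _ (cg _ (Arho p))) => W /= AW.
have := crho p _ AW; rewrite !nbhs_simpl/=; apply: filterS => q; exact.
Qed.

(** The intervals of centre u k and radius 2 M / 2 ^ k are nested, and the
    limit is the supremum of their left endpoints. *)
Lemma geometric_limit {R : realType} (u : nat -> R) (M : R) :
  (forall k, `|u k.+1 - u k| <= M / 2 ^+ k) ->
  exists l, forall k, `|l - u k| <= 2 * M / 2 ^+ k.
Proof.
move=> uM; pose d k := 2 * M / 2 ^+ k.
have dS k : d k - d k.+1 = M / 2 ^+ k.
  by rewrite /d exprS; field; rewrite expf_neq0.
have M0 : 0 <= M by have := uM 0%N; rewrite expr0 divr1; exact: le_trans.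
have d0 k : 0 <= d k by rewrite /d !mulr_ge0// invr_ge0 exprn_ge0.
have lo : {homo (fun k => u k - d k) : i j / (i <= j)%N >-> i <= j}.
  apply: homo_leq => [//|y x z|k]; first exact: le_trans.
  by have := uM k; rewrite ler_norml -dS => /andP[]; lra.
have hi : {homo (fun k => u k + d k) : i j / (i <= j)%N >-> j <= i}.
  apply: homo_leq => [//|y x z yx zy|k]; first exact: le_trans zy yx.
  by have := uM k; rewrite ler_norml -dS => /andP[]; lra.
have lohi i j : u i - d i <= u j + d j.
  have [/lo ij|/ltnW/hi ij] := leqP i j.
    by apply: le_trans ij _; have := d0 j; lra.
  by apply: le_trans ij; have := d0 i; lra.
pose E := range (fun k => u k - d k).
exists (sup E) => k; rewrite ler_norml -/(d k); apply/andP; split.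
  rewrite lerBrDl; apply: ub_le_sup; last by exists k.
  by exists (u 0 + d 0) => _ [i _ <-].
rewrite lerBlDl; apply: ge_sup; first by exists (u 0 - d 0); exists 0%N.
by move=> _ [i _ <-].
Qed.

Lemma geometric_cvg {R : realType} {V : normedModType R} (u : nat -> V) (l : V)
    (C : R) :
  (forall k, `|l - u k| <= C / 2 ^+ k) -> u @ \oo --> l.
Proof.
move=> uC; apply/cvgrPdist_le => e e0.
have half : `|2^-1 : R| < 1 by rewrite ger0_norm ?invr_ge0//; lra.
have := cvg_geometric C half; move/cvgrPdist_le => /(_ e e0).
apply: filterS => k; rewrite /geometric/= sub0r normrN => ge.
by rewrite (le_trans (uC k))// (le_trans _ ge)// exprVn ler_norm.
Qed.

(** * Locally bounded measurable functions *)

(** This class contains the continuous functions and the measurable controls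
    with bounded values, is stable under pointwise operations and primitives,
    and its members are integrable on segments, so that integrability never has
    to be carried along. *)
Definition locally_bounded_measurable {R : realType} (g : R -> R) : Prop :=
  measurable_fun setT g /\
  forall a b : R, exists M : R, forall s, a <= s <= b -> `|g s| <= M.

Definition lbm_vector {R : realType} {n} (g : R -> 'rV[R]_n) : Prop :=
  forall j, locally_bounded_measurable (fun t => g t ord0 j).

Notation lbm := locally_bounded_measurable.

Section lbm.
Context {R : realType}.
Notation mu := (@lebesgue_measure R).
Implicit Types g h : R -> R.

Lemma lbm_integrable g a b : lbm g -> mu.-integrable `[a, b] (EFin \o g).
Proof.
move=> [mg /(_ a b)[M gM]]; apply: measurable_bounded_integrable => //.
- exact: compact_finite_measure (@segment_compact _ _ _).
- exact: measurable_funTS.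
- exists M; split; first exact: num_real.
  by move=> y My s /= sab; rewrite (le_trans _ (ltW My))// gM//.
Qed.

Lemma lbm_cst c : lbm (cst c : R -> R).
Proof. by split => // a b; exists `|c|. Qed.

Lemma lbm_continuous g : continuous g -> lbm g.
Proof.
move=> cg; split; first exact: continuous_measurable_fun.
move=> a b; have [ab|ba] := leP a b; last first.
  exists 0 => s /andP[sa sb]; exfalso.
  by move: (le_trans sa sb); rewrite leNgt ba.
have cn : {within `[a, b], continuous (fun s => `|g s|)}.
  apply: continuous_subspaceT => s.
  exact: (continuous_comp (cg s) (@norm_continuous _ _ _)).
have [c _ cP] := EVT_max ab cn.
by exists `|g c| => s sab; apply: cP; rewrite in_itv.
Qed.

Lemma lbmD g h : lbm g -> lbm h -> lbm (fun t => g t + h t).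
Proof.
move=> [mg bg] [mh bh]; split; first exact: measurable_funD.
move=> a b; have [M gM] := bg a b; have [N hN] := bh a b.
by exists (M + N) => s sab; rewrite (le_trans (ler_normD _ _))// lerD ?gM ?hN.
Qed.

Lemma lbmM g h : lbm g -> lbm h -> lbm (fun t => g t * h t).
Proof.
move=> [mg bg] [mh bh]; split; first exact: measurable_funM.
move=> a b; have [M gM] := bg a b; have [N hN] := bh a b.
by exists (M * N) => s sab; rewrite normrM ler_pM ?gM ?hN.
Qed.

Lemma lbmZ c g : lbm g -> lbm (fun t => c * g t).
Proof. exact: lbmM (lbm_cst c). Qed.

Lemma lbmB g h : lbm g -> lbm h -> lbm (fun t => g t - h t).
Proof.
move=> lg lh; under eq_fun do rewrite -mulN1r.
by apply: lbmD => //; exact: lbmZ.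
Qed.

Lemma lbm_sum I (s : seq I) (g : I -> R -> R) :
  (forall i, lbm (g i)) -> lbm (fun t => \sum_(i <- s) g i t).
Proof.
move=> lg; elim: s => [|i s IH].
  by under eq_fun do rewrite big_nil; exact: lbm_cst.
by under eq_fun do rewrite big_cons; exact: lbmD.
Qed.

Lemma lbm_le g h : measurable_fun setT g -> lbm h ->
  (forall t, `|g t| <= h t) -> lbm g.
Proof.
move=> mg [_ bh] gh; split=> // a b; have [M hM] := bh a b; exists M => s sab.
by rewrite (le_trans (gh s))// (le_trans _ (hM s sab))// ler_norm.
Qed.

End lbm.

(** * Integrals over segments *)

Section integral_on_segment.
Context {R : realType}.
Notation mu := (@lebesgue_measure R).
Implicit Types (g h : R -> R) (a b c : R).

Lemma int_split g a b c : lbm g -> a <= b -> b <= c ->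
  \int[mu]_(s in `[a, c]) g s =
  \int[mu]_(s in `[a, b]) g s + \int[mu]_(s in `[b, c]) g s.
Proof.
move=> lg ab bc; apply/eqP; rewrite addrC -subr_eq; apply/eqP.
rewrite Rintegral_itvB ?bnd_simp//; last exact: lbm_integrable.
rewrite Rintegral_itv_obnd_cbnd//.
apply: integrableS (lbm_integrable a c lg) => //.
by apply: subset_itv; rewrite bnd_simp.
Qed.

Lemma int_le g h a b : lbm g -> lbm h ->
  (forall s, a <= s <= b -> g s <= h s) ->
  \int[mu]_(s in `[a, b]) g s <= \int[mu]_(s in `[a, b]) h s.
Proof.
by move=> lg lh gh; apply: le_Rintegral => //; exact: lbm_integrable.
Qed.

Lemma int_abs_le_cst g a b M : lbm g -> a <= b ->
  (forall s, a <= s <= b -> `|g s| <= M) ->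
  `|\int[mu]_(s in `[a, b]) g s| <= M * (b - a).
Proof.
move=> lg ab gM.
have int_cst c : \int[mu]_(s in `[a, b]) c = c * (b - a).
  rewrite Rintegral_cst//; congr (_ * _).
  apply: etrans (congr1 fine (lebesgue_measure_itv `[a, b])) _.
  rewrite /= lte_fin; case: ltP => [_ //|ba].
  by rewrite (le_anti (introT andP (conj ab ba))) subrr.
rewrite ler_norml -mulNr -!int_cst; apply/andP; split; apply: int_le => //;
  try exact: lbm_cst; by move=> s /gM; rewrite ler_norml => /andP[].
Qed.

Lemma int_itv_ge g a b : b <= a -> \int[mu]_(s in `[a, b]) g s = 0.
Proof.
rewrite le_eqVlt => /predU1P[->|ba]; first by rewrite set_itv1 Rintegral_set1.
by rewrite set_itv_ge ?bnd_simp -?ltNge// Rintegral_set0.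
Qed.

Lemma int_increment_le g a b c M : lbm g -> a <= b -> b <= c ->
  (forall s, b <= s <= c -> `|g s| <= M) ->
  `|\int[mu]_(s in `[a, c]) g s - \int[mu]_(s in `[a, b]) g s| <= M * (c - b).
Proof.
move=> lg ab bc gM.
by rewrite (int_split _ ab bc)// addrAC subrr add0r int_abs_le_cst.
Qed.

Lemma primitive_continuous g a : lbm g ->
  continuous (fun t => \int[mu]_(s in `[a, t]) g s).
Proof.
move=> lg t; have [M0 gM0] := lg.2 a (t + 1).
pose M := `|M0| + 1.
have M_gt0 : 0 < M by rewrite ltr_wpDl.
have gM s : a <= s <= t + 1 -> `|g s| <= M.
  move=> /gM0 gs; rewrite (le_trans gs)// (le_trans (ler_norm _))// /M lerDl.
  exact: ler01.
have main u v : a <= u -> u <= v -> v <= t + 1 ->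
    `|\int[mu]_(s in `[a, v]) g s - \int[mu]_(s in `[a, u]) g s|
    <= M * (v - u).
  move=> au uv vt; apply: int_increment_le => // s /andP[us sv].
  by apply: gM; rewrite (le_trans au us) (le_trans sv vt).
(* Left of a the segment is empty and the primitive vanishes. *)
have primE u : \int[mu]_(s in `[a, u]) g s =
    \int[mu]_(s in `[a, Num.max a u]) g s.
  by rewrite maxEle; case: leP => // ua; rewrite !int_itv_ge// ltW.
have max_lip u v : u <= v -> Num.max a v - Num.max a u <= v - u.
  move=> uv; rewrite (le_trans (ler_norm _))// (le_trans (dist_max _ _ _))//.
  by rewrite ger0_norm// subr_ge0.
have lip u v : u <= v -> v <= t + 1 -> a <= t + 1 ->
    `|\int[mu]_(s in `[a, v]) g s - \int[mu]_(s in `[a, u]) g s|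
    <= M * (v - u).
  move=> uv vt at1; rewrite (primE v) (primE u).
  apply: le_trans (main _ _ _ _ _) _.
  - by rewrite le_max lexx.
  - by rewrite ge_max !le_max lexx uv orbT.
  - by rewrite ge_max at1.
  - by rewrite ler_pM2l// max_lip.
apply/cvgrPdist_le => e e_gt0; near=> u.
have ut1 : u <= t + 1 by apply/ltW; near: u; apply: lt_nbhsl; rewrite ltrDl.
have [at1|at1] := leP a (t + 1); last first.
  rewrite !int_itv_ge ?subrr ?normr0 ?(ltW e_gt0)//.
    by rewrite (le_trans ut1)// ltW.
  by rewrite (le_trans _ (ltW at1))// lerDl.
have tu : `|t - u| <= e / M.
  by near: u; apply: cvgr_dist_le; [exact: cvg_id|rewrite divr_gt0].
have [ut|/ltW tu'] := leP u t.
  rewrite (le_trans (lip _ _ ut _ _))// ?lerDl//.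
  by rewrite mulrC -ler_pdivlMr// (le_trans (ler_norm _)).
rewrite distrC (le_trans (lip _ _ tu' _ _))// mulrC -ler_pdivlMr//.
by rewrite (le_trans (ler_norm _))// distrC.
Unshelve. all: by end_near. Qed.

Lemma lbm_primitive g a : lbm g -> lbm (fun t => \int[mu]_(s in `[a, t]) g s).
Proof. by move=> lg; apply/lbm_continuous/primitive_continuous. Qed.

Lemma int_sum I (r : seq I) (g : I -> R -> R) a b : (forall i, lbm (g i)) ->
  \int[mu]_(s in `[a, b]) (\sum_(i <- r) g i s) =
  \sum_(i <- r) \int[mu]_(s in `[a, b]) g i s.
Proof.
move=> lg; elim: r => [|i r IH].
  rewrite big_nil; under eq_Rintegral do rewrite big_nil.
  by rewrite Rintegral_cst// mul0r.
rewrite big_cons -IH -RintegralD//; try exact: lbm_integrable.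
- by under eq_Rintegral do rewrite big_cons.
- exact/lbm_integrable/lbm_sum.
Qed.

Lemma intZ c g a b : lbm g -> \int[mu]_(s in `[a, b]) (c * g s) =
  c * \int[mu]_(s in `[a, b]) g s.
Proof. by move=> lg; apply: RintegralZl => //; exact: lbm_integrable. Qed.

Lemma lbm_enorm n (g : R -> 'rV[R]_n) :
  lbm_vector g -> lbm (fun t => enorm (g t)).
Proof.
move=> lg; apply: (@lbm_le _ _ (fun t => \sum_(j < n) `|g t ord0 j|)).
- apply: (@measurableT_comp _ _ _ _ _ _ (@Num.sqrt R)).
    exact: continuous_measurable_fun (@sqrt_continuous _).
  apply: measurable_sum => j; apply: measurable_funX; exact: (lg j).1.
- apply: lbm_sum => j; split.
    by apply: measurableT_comp => //; exact: (lg j).1.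
  move=> a b; have [M gM] := (lg j).2 a b; exists M => s /gM.
  by rewrite normr_id.
- by move=> t; rewrite ger0_norm ?enorm_ge0// enorm_le_sum.
Qed.

Definition vint n (g : R -> 'rV[R]_n) a b : 'rV[R]_n :=
  \row_j \int[mu]_(s in `[a, b]) g s ord0 j.

(** Let w be the integral: the square of its norm is the integral of the scalar
    product of w and g, which is at most |w| |g| by Cauchy-Schwarz. The
    Euclidean norm is needed with constant 1, because any extra factor would
    spoil the comparison of the Lipschitz constant with the discount rate. *)
Lemma enorm_vint_le n (g : R -> 'rV[R]_n) a b : lbm_vector g ->
  enorm (vint g a b) <= \int[mu]_(s in `[a, b]) enorm (g s).
Proof.
move=> lg; set w := vint g a b.
have int_ge0 : 0 <= \int[mu]_(s in `[a, b]) enorm (g s).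
  by apply: Rintegral_ge0 => s _; exact: enorm_ge0.
have [w0|w_gt0] := leP (enorm w) 0; first exact: le_trans w0 _.
rewrite -(ler_pM2l w_gt0) -expr2 enorm_sqr.
have -> : \sum_(j < n) w ord0 j ^+ 2 =
    \int[mu]_(s in `[a, b]) \sum_(j < n) (w ord0 j * g s ord0 j).
  rewrite int_sum => [|j]; last exact: lbmZ.
  by apply: eq_bigr => j _; rewrite intZ// expr2 {2}/w mxE.
rewrite -intZ; last exact: lbm_enorm.
apply: int_le => [||s _]; last exact: dot_le_enorm.
- by apply: lbm_sum => j; exact: lbmZ.
- exact/lbmZ/lbm_enorm.
Qed.

End integral_on_segment.

(** * Exponential weights and Gronwall's inequality *)

Section exponential_weight.
Context {R : realType}.
Notation mu := (@lebesgue_measure R).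
Implicit Types (r a b : R).

Lemma continuous_exp_weight r a : continuous (fun s : R => expR (r * (s - a))).
Proof.
move=> s; apply: (@continuous_comp _ _ _ (fun s => r * (s - a)) expR).
  apply: (@continuousM _ R^o); first exact: cst_continuous.
  apply: (@continuousB _ R^o); [exact: cvg_id|exact: cst_continuous].
exact: continuous_expR.
Qed.

Lemma lbm_exp_weight r a : lbm (fun s : R => expR (r * (s - a))).
Proof. exact/lbm_continuous/continuous_exp_weight. Qed.

Lemma is_derive_exp_weight r a (s : R) : r != 0 ->
  is_derive s 1 (fun s : R => expR (r * (s - a)) / r) (expR (r * (s - a))).
Proof.
move=> r0; pose lin (s : R) := r * (s - a).
have dlin : is_derive s (1 : R) lin r.
  by apply: (@is_derive_eq _ _ _ lin); rewrite /GRing.scale/=; ring.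
have dexp : is_derive s (1 : R) (expR \o lin) (r * expR (lin s)).
  by apply: (@is_derive_eq _ _ _ (expR \o lin)); rewrite /GRing.scale/=; ring.
apply: (@is_derive_eq _ _ _ (fun s => (expR \o lin) s * r^-1)).
by rewrite /GRing.scale/= /lin; field.
Qed.

Lemma int_exp_weight r a b : r != 0 -> a <= b ->
  \int[mu]_(s in `[a, b]) expR (r * (s - a)) = (expR (r * (b - a)) - 1) / r.
Proof.
move=> r0; rewrite le_eqVlt => /predU1P[<-|ab].
  by rewrite int_itv_ge// subrr mulr0 expR0 subrr mul0r.
pose F (s : R) := expR (r * (s - a)) / r.
have dF s : is_derive s (1 : R) F (expR (r * (s - a))).
  exact: is_derive_exp_weight.
have cF : continuous F.
  move=> s; apply: differentiable_continuous.
  by apply/derivable1_diffP; case: (dF s).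
rewrite /Rintegral (@continuous_FTC2 _ _ F)//.
- by rewrite /F subrr mulr0 expR0 mulrBl.
- exact/continuous_subspaceT/continuous_exp_weight.
- split.
  + by move=> s _; case: (dF s).
  + exact/cvg_at_right_filter/cF.
  + exact/cvg_at_left_filter/cF.
- by move=> s _; rewrite derive1E; case: (dF s).
Qed.

Lemma int_exp_weight_tail r a : 0 < r ->
  (\int[mu]_(s in `[a, +oo[) (expR (- r * (s - a)))%:E = (r^-1)%:E)%E.
Proof.
move=> r0; have nr0 : - r != 0 by rewrite oppr_eq0 gt_eqF.
pose F (s : R) := expR (- r * (s - a)) / - r.
have dF s : is_derive s (1 : R) F (expR (- r * (s - a))).
  exact: is_derive_exp_weight.
have cF : continuous F.
  move=> s; apply: differentiable_continuous.
  by apply/derivable1_diffP; case: (dF s).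
rewrite (@ge0_continuous_FTC2y _ _ F _ 0)//.
- by rewrite /F subrr mulr0 expR0 sub0e -EFinN invrN mul1r opprK.
- exact/continuous_subspaceT/continuous_exp_weight.
- rewrite -[X in _ --> X](mul0r (- r)^-1).
  apply: (@cvgMl _ R^o).
  rewrite (_ : (fun x => _) = (fun z => expR (- z)) \o (fun s => r * (s - a))).
    apply: (@cvg_comp _ _ _ _ _ _ (pinfty_nbhs R)); last exact: cvgr_expR.
    apply: gt0_cvgMry => //; exact: cvg_addrr.
  by apply: eq_fun => x /=; rewrite mulNr.
- exact/cvg_at_right_filter/cF.
- by move=> s _; rewrite derive1E; case: (dF s).
Qed.

Lemma integrable_exp_weight_tail r a : 0 < r ->
  mu.-integrable `[a, +oo[ (EFin \o (fun s => expR (- r * (s - a)))).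
Proof.
move=> r0; apply/integrableP; split.
  apply/measurable_EFinP; apply: measurable_funTS.
  exact: (lbm_exp_weight (- r) a).1.
under eq_integral do rewrite /= ger0_norm ?expR_ge0//.
by rewrite int_exp_weight_tail// ltry.
Qed.

End exponential_weight.

(** Let N be the supremum of phi s * exp (- r (s - tau)) over a segment.
    Inserting phi s <= N exp (r (s - tau)) under the integral gives N <= a + (K
    / r) N, whence N <= r / (r - K) * a as K < r. *)
Lemma gronwall {R : realType} (phi : R -> R) (tau a K r : R) :
  lbm phi -> (forall t, 0 <= phi t) -> 0 <= K -> K < r ->
  (forall t, tau <= t ->
     phi t <= a + K * \int[@lebesgue_measure R]_(s in `[tau, t]) phi s) ->
  forall t, tau <= t -> phi t <= r / (r - K) * a * expR (r * (t - tau)).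
Proof.
move=> lphi phi0 K0 Kr phiP T tauT.
have r0 : 0 < r by exact: le_lt_trans K0 Kr.
have a0 : 0 <= a.
  have := phiP tau (lexx _); rewrite int_itv_ge// mulr0 addr0.
  exact: le_trans.
pose w s := phi s * expR (- r * (s - tau)).
pose E := [set w s | s in `[tau, T]].
have lw : lbm w by apply: lbmM => //; exact: lbm_exp_weight.
have Eub : has_ubound E.
  have [M wM] := lw.2 tau T; exists M => _ [s sT <-].
  by rewrite (le_trans (ler_norm _))// wM//; move: sT; rewrite /= in_itv.
have wN s : tau <= s <= T -> w s <= sup E.
  by move=> sT; apply: ub_le_sup => //; exists s => //=; rewrite in_itv.
have phiE s : phi s = w s * expR (r * (s - tau)).
  by rewrite /w -mulrA -expRD mulNr addNr expR0 mulr1.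
have sup_ge0 : 0 <= sup E.
  by apply: le_trans (wN tau _); rewrite ?lexx// mulr_ge0 ?expR_ge0.
have w_le s : tau <= s <= T -> w s <= a + K * (sup E / r).
  move=> /andP[ts sT].
  rewrite -(ler_pM2r (expR_gt0 (r * (s - tau)))) -phiE.
  have int_bound : \int[@lebesgue_measure R]_(v in `[tau, s]) phi v <=
      sup E * ((expR (r * (s - tau)) - 1) / r).
    rewrite -int_exp_weight ?gt_eqF// -intZ; last exact: lbm_exp_weight.
    apply: int_le => // [|v /andP[tv vs]]; first exact/lbmZ/lbm_exp_weight.
    by rewrite phiE ler_wpM2r ?expR_ge0// wN// tv (le_trans vs sT).
  have exp_ge1 : 1 <= expR (r * (s - tau)).
    by rewrite -[leLHS]expR0 ler_expR mulr_ge0 ?(ltW r0)// subr_ge0.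
  apply: le_trans (phiP s ts) _.
  have : K * \int[@lebesgue_measure R]_(v in `[tau, s]) phi v <=
      K * (sup E / r) * expR (r * (s - tau)) - K * (sup E / r).
    apply: le_trans (ler_wpM2l K0 int_bound) _.
    by rewrite le_eqVlt; apply/orP; left; apply/eqP; field; rewrite gt_eqF.
  have KN : 0 <= K * (sup E / r) by rewrite mulr_ge0// divr_ge0// ltW.
  nra.
have supE_le : sup E <= r / (r - K) * a.
  have : sup E <= a + K * (sup E / r).
    apply: ge_sup; first by exists (w tau), tau => //=; rewrite in_itv/= lexx.
    by move=> _ [s sT <-]; apply: w_le; move: sT; rewrite /= in_itv.
  rewrite -(ler_pM2r r0) mulrDl -(mulrA K) divfK ?gt_eqF// => NP.
  have rK : 0 < r - K by rewrite subr_gt0.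
  rewrite -(ler_pM2r rK) mulrAC divfK ?gt_eqF//; lra.
rewrite phiE ler_wpM2r ?expR_ge0// (le_trans (wN _ _) supE_le)//.
by rewrite tauT lexx.
Qed.

Lemma integrable_decay {R : realType} (g : R -> R) (tau C rate : R) :
  0 < rate -> measurable_fun setT g ->
  (forall t, tau <= t -> `|g t| <= C * expR (- rate * (t - tau))) ->
  (@lebesgue_measure R).-integrable `[tau, +oo[ (EFin \o g).
Proof.
move=> rate0 mg gC.
have int_exp := integrableZl _ C (integrable_exp_weight_tail tau rate0).
apply: le_integrable (int_exp _) => //.
  by apply/measurable_EFinP; exact: measurable_funTS.
move=> t; rewrite /= in_itv/= andbT => /gC gt.
by rewrite lee_fin (le_trans gt)// ler_norm.
Qed.

Lemma int_decay_le {R : realType} (g : R -> R) (tau C rate : R) :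
  0 < rate -> measurable_fun setT g ->
  (forall t, tau <= t -> `|g t| <= C * expR (- rate * (t - tau))) ->
  `|\int[@lebesgue_measure R]_(t in `[tau, +oo[) g t| <= C / rate.
Proof.
move=> rate0 mg gC; have ig := integrable_decay rate0 mg gC.
have ie := integrable_exp_weight_tail tau rate0.
rewrite (le_trans (le_normr_Rintegral _ _))//.
have -> : C / rate = \int[@lebesgue_measure R]_(t in `[tau, +oo[)
    (C * expR (- rate * (t - tau))).
  by rewrite RintegralZl// [X in _ = _ * X]/Rintegral int_exp_weight_tail.
apply: le_Rintegral => //.
- exact: integrable_abse ig.
- exact: (integrableZl _ C ie).
- by move=> t; rewrite /= in_itv/= andbT; exact: gC.
Qed.

(** * Differential equations measurable in time *)

(** The right-hand side after substitution of a control, hence only measurable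
    in time. Measurability is required along curves because this is the form in
    which it is used, and it avoids a sigma-algebra on the state space. *)
Definition lipschitz_field {R : realType} {n} (G : R -> 'rV[R]_n -> 'rV[R]_n)
    (K B : R) : Prop :=
  [/\ forall x, lbm_vector x -> forall j,
        measurable_fun setT (fun t => G t (x t) ord0 j),
      forall t x y, enorm (G t x - G t y) <= K * enorm (x - y) &
      forall t, enorm (G t 0) <= B].

Definition solution {R : realType} {n} (G : R -> 'rV[R]_n -> 'rV[R]_n)
    (tau : R) (z : 'rV[R]_n) (x : R -> 'rV[R]_n) : Prop :=
  lbm_vector x /\
  forall t, tau <= t -> x t = z + vint (fun s => G s (x s)) tau t.

Section vector_integrals.
Context {R : realType} {n : nat}.
Implicit Types g h : R -> 'rV[R]_n.

Lemma lbm_vectorB g h : lbm_vector g -> lbm_vector h ->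
  lbm_vector (fun t => g t - h t).
Proof.
by move=> lg lh j; under eq_fun do rewrite !mxE; exact: lbmB.
Qed.

Lemma vintB g h a b : lbm_vector g -> lbm_vector h ->
  vint (fun s => g s - h s) a b = vint g a b - vint h a b.
Proof.
move=> lg lh; apply/rowP => j; rewrite !mxE -RintegralB//;
  try exact: lbm_integrable.
by apply: eq_Rintegral => s _; rewrite !mxE.
Qed.

Lemma vint_split g a b c : lbm_vector g -> a <= b -> b <= c ->
  vint g a c = vint g a b + vint g b c.
Proof.
by move=> lg ab bc; apply/rowP => j; rewrite !mxE (int_split _ ab bc).
Qed.

Lemma vint_ge g a b : b <= a -> vint g a b = 0.
Proof. by move=> ba; apply/rowP => j; rewrite !mxE int_itv_ge. Qed.

End vector_integrals.

Section ode.
Context {R : realType} {n : nat}.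
Variables (G : R -> 'rV[R]_n -> 'rV[R]_n) (K B : R).
Hypotheses (K_gt0 : 0 < K) (GP : lipschitz_field G K B).
Notation mu := (@lebesgue_measure R).
Implicit Types (x y : R -> 'rV[R]_n) (z w : 'rV[R]_n).

Let B_ge0 : 0 <= B.
Proof. by have [_ _ /(_ 0)] := GP; apply: le_trans; exact: enorm_ge0. Qed.

Lemma field_le t z : enorm (G t z) <= B + K * enorm z.
Proof.
have [_ Glip GB] := GP; rewrite (le_trans (enorm_leB _ (G t 0)))// lerD//.
by rewrite (le_trans (Glip _ _ _))// subr0.
Qed.

Lemma lbm_growth x : lbm_vector x -> lbm (fun t => B + K * enorm (x t)).
Proof. by move=> lx; apply: lbmD; [exact: lbm_cst|exact/lbmZ/lbm_enorm]. Qed.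

Lemma lbm_field x : lbm_vector x -> lbm_vector (fun t => G t (x t)).
Proof.
move=> lx j; apply: lbm_le (lbm_growth lx) _.
  by have [+ _ _] := GP; exact.
by move=> t; rewrite (le_trans (coord_le_enorm _ _))// field_le.
Qed.

(** The quantity B + K |x|, rather than |x| itself, satisfies a Gronwall
    inequality without inhomogeneous term, and it bounds the right-hand side.
    *)
Lemma solution_growth r tau z x : K < r -> solution G tau z x ->
  forall t, tau <= t ->
  B + K * enorm (x t) <= r / (r - K) * (B + K * enorm z) * expR (r * (t - tau)).
Proof.
move=> Kr [lx xE]; apply: gronwall => //; first exact: lbm_growth.
- by move=> t; rewrite addr_ge0// mulr_ge0 ?enorm_ge0// ltW.
- exact: ltW.
move=> t tt; rewrite -addrA lerD2l -mulrDr ler_pM2l// xE//.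
rewrite (le_trans (enorm_triangle _ _))// lerD2l.
rewrite (le_trans (enorm_vint_le _ _ (lbm_field lx)))// int_le//.
- exact/lbm_enorm/lbm_field.
- exact: lbm_growth.
by move=> s _; exact: field_le.
Qed.

Lemma solution_dist r tau z w x y : K < r ->
  solution G tau z x -> solution G tau w y -> forall t, tau <= t ->
  enorm (x t - y t) <= r / (r - K) * enorm (z - w) * expR (r * (t - tau)).
Proof.
move=> Kr [lx xE] [ly yE].
have lxy := lbm_enorm (lbm_vectorB lx ly).
apply: gronwall => //; first by move=> t; exact: enorm_ge0.
  exact: ltW.
move=> t tt; rewrite xE// yE// opprD addrACA -vintB; try exact: lbm_field.
rewrite (le_trans (enorm_triangle _ _))// lerD2l.
have lG := lbm_vectorB (lbm_field lx) (lbm_field ly).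
rewrite (le_trans (enorm_vint_le _ _ lG))// -intZ// int_le//.
- exact: lbm_enorm.
- exact: lbmZ.
by move=> s _; have [_ + _] := GP; exact.
Qed.

Lemma solution_restart tau sigma z x : tau <= sigma -> solution G tau z x ->
  solution G sigma (x sigma) x.
Proof.
move=> ts [lx xE]; split => // t st.
rewrite (xE t (le_trans ts st)) (vint_split _ ts st) ?addrA -?xE//.
exact: lbm_field.
Qed.

Lemma solution_increment r tau z x a b : K < r -> solution G tau z x ->
  tau <= a -> a <= b ->
  enorm (x b - x a) <=
    r / (r - K) * (B + K * enorm z) * expR (r * (b - tau)) * (b - a).
Proof.
move=> Kr xsol ta ab; have [lx _] := xsol.
have [_ /(_ b ab) ->] := solution_restart ta xsol.
have lG := lbm_field lx.
rewrite addrAC subrr add0r (le_trans (enorm_vint_le _ _ lG))//.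
rewrite (le_trans (ler_norm _))// int_abs_le_cst//; first exact: lbm_enorm.
move=> s /andP[as_ sb]; rewrite ger0_norm ?enorm_ge0//.
rewrite (le_trans (field_le _ _))//.
apply: le_trans (solution_growth Kr xsol (le_trans ta as_)) _.
have r0 : 0 < r by exact: lt_trans Kr.
rewrite ler_wpM2l//.
  rewrite mulr_ge0 ?divr_ge0 ?(ltW r0) ?subr_ge0 ?(ltW Kr)//.
  by rewrite addr_ge0// mulr_ge0 ?enorm_ge0// ltW.
by rewrite ler_expR ler_pM2l// lerD2r.
Qed.

Fixpoint picard tau z k (t : R) : 'rV[R]_n :=
  if k is k'.+1 then z + vint (fun s => G s (picard tau z k' s)) tau t else z.

Lemma lbm_picard tau z k : lbm_vector (picard tau z k).
Proof.
elim: k => [|k IH] j; first exact: lbm_cst.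
rewrite /=; under eq_fun do rewrite !mxE.
by apply: lbmD; [exact: lbm_cst|apply: lbm_primitive; exact: lbm_field].
Qed.

(** In the norm weighted by exp (- 2 K (t - tau)) the Picard map contracts by
    one half on the whole half line, because K times the integral of exp (2 K
    (s - tau)) is at most exp (2 K (t - tau)) / 2. *)
Lemma picard_contract tau z k t :
  enorm (picard tau z k.+1 t - picard tau z k t) <=
    (B + K * enorm z) / (2 * K) / 2 ^+ k * expR (2 * K * (t - tau)).
Proof.
set C := B + K * enorm z.
have C0 : 0 <= C by rewrite addr_ge0// mulr_ge0 ?enorm_ge0// ltW.
have K20 : 0 < 2 * K by rewrite mulr_gt0.
have rhs_ge0 i s : 0 <= C / (2 * K) / 2 ^+ i * expR (2 * K * (s - tau)).
  by rewrite mulr_ge0 ?expR_ge0// !divr_ge0 ?exprn_ge0// ltW.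
have [tt|/ltW tt] := leP tau t; last first.
  suff E i : picard tau z i t = z by rewrite !E subrr enorm0.
  by case: i => [//|i] /=; rewrite vint_ge// addr0.
elim: k t tt => [|k IH] t tt.
  (* The first step is at most C (t - tau), and y <= exp y is applied to
     y = 2 K (t - tau). *)
  rewrite /= addrAC subrr add0r expr0 divr1.
  have lG : lbm_vector (fun s => G s z).
    exact: (lbm_field (lbm_picard tau z 0)).
  rewrite (le_trans (enorm_vint_le _ _ lG))// (le_trans (ler_norm _))//.
  apply: (@le_trans _ _ (C * (t - tau))).
    apply: int_abs_le_cst => // [|s _]; first exact: lbm_enorm.
    by rewrite ger0_norm ?enorm_ge0// field_le.
  rewrite -mulrA ler_wpM2l// mulrC ler_pdivlMr// mulrC.
  by rewrite (le_trans _ (expR_ge1Dx _))// lerDr.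
have lk := lbm_picard tau z k; have lk1 := lbm_picard tau z k.+1.
rewrite [picard tau z k.+2]/= [X in _ - X]/= opprD addrACA subrr add0r.
rewrite -vintB; try exact: lbm_field.
have lG := lbm_vectorB (lbm_field lk1) (lbm_field lk).
rewrite (le_trans (enorm_vint_le _ _ lG))//.
set M := C / (2 * K) / 2 ^+ k.
apply: (@le_trans _ _ (\int[mu]_(s in `[tau, t])
    (K * M * expR (2 * K * (s - tau))))).
  apply: int_le => [||s /andP[ts st]]; first exact: lbm_enorm.
    exact/lbmZ/lbm_exp_weight.
  have [_ Glip _] := GP; rewrite (le_trans (Glip _ _ _))//.
  by rewrite -mulrA ler_pM2l// IH.
rewrite intZ; last exact: lbm_exp_weight.
rewrite int_exp_weight ?gt_eqF//.
have -> : C / (2 * K) / 2 ^+ k.+1 = K * M / (2 * K).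
  by rewrite /M exprS; field; rewrite ?expf_neq0 ?gt_eqF.
rewrite -[leRHS]mulrA [X in _ <= _ * X]mulrC ler_wpM2l//.
  by rewrite mulr_ge0 ?(ltW K_gt0)// !divr_ge0 ?exprn_ge0// ltW.
by rewrite ler_pM2r ?invr_gt0// gerBl.
Qed.

(** The Picard iterates converge geometrically at each time, with a locally
    bounded factor W; this is enough for the limit to be measurable and to pass
    to the limit under the integral. *)
Lemma solution_exists tau z : exists x, solution G tau z x.
Proof.
pose M := (B + K * enorm z) / (2 * K).
pose W t := 2 * (M * expR (2 * K * (t - tau))).
have lW : lbm W by apply/lbmZ/lbmZ/lbm_exp_weight.
have lim t j : exists v, forall k,
    `|v - picard tau z k t ord0 j| <= W t / 2 ^+ k.
  apply: geometric_limit => k.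
  have := coord_le_enorm (picard tau z k.+1 t - picard tau z k t) j.
  rewrite !mxE => /le_trans; apply.
  by rewrite (le_trans (picard_contract _ _ _ _))// mulrAC.
have [xc xcP] : exists xc : R -> 'I_n -> R, forall t j k,
    `|xc t j - picard tau z k t ord0 j| <= W t / 2 ^+ k.
  have : forall t, exists c : 'I_n -> R, forall j k,
    `|c j - picard tau z k t ord0 j| <= W t / 2 ^+ k.
    by move=> t; have [c cP] := choice (lim t); exists c.
  by move=> /choice[f fP]; exists f.
pose x t : 'rV[R]_n := \row_j xc t j.
have xP t j k : `|x t ord0 j - picard tau z k t ord0 j| <= W t / 2 ^+ k.
  by rewrite mxE.
have lx : lbm_vector x.
  move=> j; split.
    apply: (@measurable_fun_cvg _ _ _ _ (fun k t => picard tau z k t ord0 j)).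
      by move=> k; exact: (lbm_picard tau z k j).1.
    by move=> t _; apply: geometric_cvg => k; exact: xP.
  move=> a b; have [N WN] := lW.2 a b.
  exists (`|z ord0 j| + N) => s sab.
  rewrite -[x s ord0 j](subrK (z ord0 j)) addrC.
  rewrite (le_trans (ler_normD _ _))// lerD2l (le_trans _ (WN s sab))//.
  rewrite (le_trans _ (ler_norm _))//.
  by have := xP s j 0%N; rewrite expr0 divr1.
exists x; split => // t tt; apply/rowP => j.
pose c := fun k => picard tau z k t ord0 j.
have : c @ \oo --> x t ord0 j by apply: geometric_cvg => k; exact: xP.
(* Both sides of the integral equation are limits of the shifted iterates. *)
rewrite -(cvg_shiftS c); move=> cx.
apply: (cvg_unique _ cx) => //.
pose Q := \int[mu]_(s in `[tau, t]) (K * (n%:R * W s)).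
have lp k := lbm_picard tau z k.
have lG k := lbm_vectorB (lbm_field lx) (lbm_field (lp k)).
have lKW : lbm (fun s => K * (n%:R * W s)) by exact/lbmZ/lbmZ.
apply: (@geometric_cvg _ _ _ _ Q) => k.
have -> : (z + vint (fun s => G s (x s)) tau t) ord0 j - c k.+1 =
    vint (fun s => G s (x s) - G s (picard tau z k s)) tau t ord0 j.
  rewrite (vintB _ _ (lbm_field lx) (lbm_field (lp k))) /c/= !mxE.
  by rewrite opprD addrACA subrr add0r.
rewrite (le_trans (coord_le_enorm _ _))//.
rewrite (le_trans (enorm_vint_le _ _ (lG k)))//.
rewrite mulrC -intZ//.
apply: int_le => [||s _]; [exact: lbm_enorm|exact: lbmZ|].
have [_ Glip _] := GP; rewrite (le_trans (Glip _ _ _))//.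
rewrite mulrCA ler_pM2l// mulrCA (le_trans (enorm_le_sum _))//.
rewrite mulr_natl -[X in _ *+ X]card_ord -sumr_const ler_sum// => i _.
by rewrite !mxE mulrC xcP.
Qed.

End ode.

(** * Measurability of superpositions *)

Section superposition.
Context {R : realType}.

Lemma measurable_countable_range (T : countType) (c : R -> T) (g : T -> R) :
  (forall y, measurable (c @^-1` [set y])) -> measurable_fun setT (g \o c).
Proof.
move=> mc _ A _; rewrite setTI.
rewrite (_ : _ @^-1` A = \bigcup_y [set t | c t = y /\ A (g y)]); last first.
  by apply/seteqP; split => [t At|t [y _ [<- ]]]//; exists (c t).
apply: countable_bigcupT_measurable; first exact: countableP.
move=> y; have [Ay|nAy] := pselect (A (g y)).
  rewrite (_ : [set t | _] = c @^-1` [set y])//.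
  by apply/seteqP; split=> t //= [].
by rewrite (_ : [set t | _] = set0)//; apply/seteqP; split=> t //= [].
Qed.

Definition dyadic_index (k : nat) (r : R) : int := Num.floor (r * 2 ^+ k).

Definition dyadic (k : nat) (i : int) : R := i%:~R / 2 ^+ k.

Lemma dyadic_dist k r : `|r - dyadic k (dyadic_index k r)| <= 1 / 2 ^+ k.
Proof.
have k0 : 0 < (2 ^+ k : R) by rewrite exprn_gt0.
have /andP[lo hi] := floor_itv (r * 2 ^+ k).
rewrite -{1}(mulfK (lt0r_neq0 k0) r) /dyadic -mulrBl normrM.
rewrite [X in _ * X]ger0_norm ?invr_ge0 ?(ltW k0)// ler_pM2r ?invr_gt0//.
rewrite ger0_norm ?subr_ge0// lerBlDl.
by rewrite ltW// (lt_le_trans hi)// intrD lexx.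
Qed.

Lemma measurable_dyadic_fiber k (g : R -> R) i : measurable_fun setT g ->
  measurable [set t | dyadic_index k (g t) = i].
Proof.
move=> mg; have k0 : 0 < (2 ^+ k : R) by rewrite exprn_gt0.
rewrite (_ : [set t | _] = setT `&` g @^-1` `[dyadic k i, dyadic k (i + 1)[).
  by apply: mg => //; exact: measurable_itv.
rewrite setTI; apply/seteqP.
split=> t /=; rewrite in_itv/= /dyadic /dyadic_index.
  by move=> <-; rewrite ler_pdivrMr// ltr_pdivlMr// floor_itv.
by rewrite ler_pdivrMr// ltr_pdivlMr// => /floor_def.
Qed.

Definition dyadic_rV {n} k (v : 'rV[int]_n) : 'rV[R]_n := map_mx (dyadic k) v.

Definition dyadic_rV_index {n} k (v : 'rV[R]_n) : 'rV[int]_n :=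
  map_mx (dyadic_index k) v.

Lemma dyadic_rV_dist {n} k (v : 'rV[R]_n) :
  `|v - dyadic_rV k (dyadic_rV_index k v)| <= 1 / 2 ^+ k.
Proof.
rewrite [leLHS]/Num.norm/= mx_normrE; apply: bigmax_le => [|[i j] _].
  by rewrite divr_ge0// exprn_ge0.
by rewrite !mxE dyadic_dist.
Qed.

Lemma measurable_dyadic_rV_fiber {n} k (x : R -> 'rV[R]_n) v :
  (forall j, measurable_fun setT (fun t => x t ord0 j)) ->
  measurable [set t | dyadic_rV_index k (x t) = v].
Proof.
move=> mx; rewrite (_ : [set t | _] =
  \bigcap_(j in [set: 'I_n]) [set t | dyadic_index k (x t ord0 j) = v ord0 j]).
  apply: fin_bigcap_measurable => [|j _]; first exact: finite_finset.
  exact: measurable_dyadic_fiber.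
apply/seteqP; split=> t /= xv.
  by move=> j _ /=; rewrite -xv mxE.
by apply/rowP => j; rewrite mxE; exact: xv.
Qed.

(** By continuity of H the function is the pointwise limit of the values of H
    at the dyadic approximations of t, x t and u t. Each approximation has a
    countable range with measurable fibers, so that any function of it is
    measurable. *)
Lemma measurable_superposition {n m} (H : R * 'rV[R]_n * 'rV[R]_m -> R)
    (x : R -> 'rV[R]_n) (u : R -> 'rV[R]_m) : continuous H ->
  (forall j, measurable_fun setT (fun t => x t ord0 j)) ->
  (forall j, measurable_fun setT (fun t => u t ord0 j)) ->
  measurable_fun setT (fun t => H (t, x t, u t)).
Proof.
move=> cH mx mu.
pose idx k t :=
  (dyadic_index k t, dyadic_rV_index k (x t), dyadic_rV_index k (u t)).
pose H_ k (i : int * 'rV[int]_n * 'rV[int]_m) :=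
  H (dyadic k i.1.1, dyadic_rV k i.1.2, dyadic_rV k i.2).
apply: (@measurable_fun_cvg _ _ _ _ (fun k => H_ k \o idx k)).
  move=> k; apply: measurable_countable_range => -[[i v] w].
  rewrite (_ : _ @^-1` _ = [set t | dyadic_index k t = i] `&`
    ([set t | dyadic_rV_index k (x t) = v] `&`
     [set t | dyadic_rV_index k (u t) = w])).
    apply: measurableI; first exact: measurable_dyadic_fiber.
    by apply: measurableI; exact: measurable_dyadic_rV_fiber.
  apply/seteqP; rewrite /idx.
  by split=> t /=; [case=> -> -> ->|case=> -> [-> ->]].
move=> t _.
have ta : (fun k => dyadic k (dyadic_index k t)) @ \oo --> t.
  by apply: (@geometric_cvg _ _ _ _ 1) => k; exact: dyadic_dist.
have xa : (fun k => dyadic_rV k (dyadic_rV_index k (x t))) @ \oo --> x t.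
  by apply: geometric_cvg => k; exact: dyadic_rV_dist.
have ua : (fun k => dyadic_rV k (dyadic_rV_index k (u t))) @ \oo --> u t.
  by apply: geometric_cvg => k; exact: dyadic_rV_dist.
exact: (cvg_comp _ _ (cvg_pair (cvg_pair ta xa) ua) (cH (t, x t, u t))).
Qed.

End superposition.

(** * Controlled trajectories and their costs *)

Section control_system.
Context {R : realType} {n m : nat}.
Variables (l : R -> 'rV[R]_n -> 'rV[R]_m -> R)
  (f : R -> 'rV[R]_n -> 'rV[R]_m -> 'rV[R]_n)
  (Omega : set 'rV[R]_m) (delta K B : R).
Hypotheses (K_gt0 : 0 < K) (delta_gt0 : 0 < delta) (K_lt_delta : K < delta).
Hypothesis lf_lipschitz : forall (t : R) (u : 'rV[R]_m), 0 <= t -> Omega u ->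
  forall x z : 'rV[R]_n,
  `|l t x u - l t z u| + enorm (f t x u - f t z u) <= K * enorm (x - z).
Hypothesis lf_at0 : forall (t : R) (u : 'rV[R]_m), 0 <= t -> Omega u ->
  `|l t 0 u| + enorm (f t 0 u) <= B.
Hypothesis l_cont : {within [set p : R * 'rV[R]_n * 'rV[R]_m | 0 <= p.1.1],
  continuous (fun p => l p.1.1 p.1.2 p.2)}.
Hypothesis f_cont : {within [set p : R * 'rV[R]_n * 'rV[R]_m | 0 <= p.1.1],
  continuous (fun p => f p.1.1 p.1.2 p.2)}.
Hypothesis Omega_nonempty : Omega !=set0.
Hypothesis Omega_bounded : bounded_set Omega.
Notation mu := (@lebesgue_measure R).
Implicit Types (x : R -> 'rV[R]_n) (u : R -> 'rV[R]_m) (z : 'rV[R]_n).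

Let B_ge0 : 0 <= B.
Proof.
have [v /(lf_at0 (lexx 0))] := Omega_nonempty.
by apply: le_trans; rewrite addr_ge0 ?enorm_ge0.
Qed.

(** Composition with this retraction onto nonnegative times turns the relative
    continuity of l and f into continuity everywhere. *)
Definition clamp (p : R * 'rV[R]_n * 'rV[R]_m) := (Num.max 0 p.1.1, p.1.2, p.2).

Lemma clamp_continuous : continuous clamp.
Proof.
move=> p.
have p11 : (fun q : R * 'rV[R]_n * 'rV[R]_m => q.1.1) @ p --> p.1.1.
  exact: (cvg_comp _ _ cvg_fst cvg_fst).
have p12 : (fun q : R * 'rV[R]_n * 'rV[R]_m => q.1.2) @ p --> p.1.2.
  exact: (cvg_comp _ _ cvg_fst cvg_snd).
have p2 : (fun q : R * 'rV[R]_n * 'rV[R]_m => q.2) @ p --> p.2.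
  exact: cvg_snd.
have pmax : (fun q : R * 'rV[R]_n * 'rV[R]_m => Num.max 0 q.1.1) @ p
    --> Num.max 0 p.1.1.
  exact: (cvg_comp _ (fun t : R => Num.max 0 t) p11
    (@max_continuous R 0 p.1.1)).
exact: (cvg_pair (cvg_pair pmax p12) p2).
Qed.

Let max0_ge0 (t : R) : 0 <= Num.max 0 t.
Proof. by rewrite le_max lexx. Qed.

Let clamp_ge0 p : [set p : R * 'rV[R]_n * 'rV[R]_m | 0 <= p.1.1] (clamp p).
Proof. by rewrite /= le_max lexx. Qed.

Let f_clamp_continuous : continuous ((fun p => f p.1.1 p.1.2 p.2) \o clamp).
Proof. exact: continuous_retract f_cont clamp_continuous clamp_ge0. Qed.

Let l_clamp_continuous : continuous ((fun p => l p.1.1 p.1.2 p.2) \o clamp).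
Proof. exact: continuous_retract l_cont clamp_continuous clamp_ge0. Qed.

Definition regular_control u :=
  (forall j, measurable_fun setT (fun t => u t ord0 j)) /\
  forall t, Omega (u t).

Definition controlled_field u (t : R) (x : 'rV[R]_n) := f (Num.max 0 t) x (u t).

Definition discounted_cost u x (t : R) :=
  expR (- (delta * t)) * l (Num.max 0 t) (x t) (u t).

Lemma field_lipschitz u : regular_control u ->
  lipschitz_field (controlled_field u) K B.
Proof.
move=> [mu_ uO]; split.
- move=> x lx j.
  apply: (@measurable_superposition _ _ _
    (fun p => f (Num.max 0 p.1.1) p.1.2 p.2 ord0 j)) => //; last first.
    by move=> i; exact: (lx i).1.
  move=> p; exact: (continuous_comp (@f_clamp_continuous p)
    (@coord_continuous R 1 n ord0 j _)).
- move=> t x y; apply: le_trans (lf_lipschitz (max0_ge0 t) (uO t) x y).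
  by rewrite lerDr.
- move=> t; apply: le_trans (lf_at0 (max0_ge0 t) (uO t)).
  by rewrite lerDr.
Qed.

Lemma cost_growth u t (x : 'rV[R]_n) : regular_control u ->
  `|l (Num.max 0 t) x (u t)| <= B + K * enorm x.
Proof.
move=> [_ uO]; rewrite -[X in `|X|](subrK (l (Num.max 0 t) 0 (u t))) addrC.
rewrite (le_trans (ler_normD _ _))// lerD//.
  by apply: le_trans (lf_at0 (max0_ge0 t) (uO t)); rewrite lerDl enorm_ge0.
rewrite -{2}[x]subr0.
apply: le_trans (lf_lipschitz (max0_ge0 t) (uO t) _ _).
by rewrite lerDl enorm_ge0.
Qed.

Lemma lbm_discounted_cost u x : regular_control u -> lbm_vector x ->
  lbm (discounted_cost u x).
Proof.
move=> ru lx; have [mu_ uO] := ru; apply: lbmM.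
  apply/lbm_continuous => t.
  apply: (@continuous_comp _ _ _ (fun t => - (delta * t)) expR).
    by apply: (@continuousN _ R^o); apply: (@continuousM _ R^o);
      [exact: cst_continuous|exact: cvg_id].
  exact: continuous_expR.
have mlx : measurable_fun setT (fun t : R => l (Num.max 0 t) (x t) (u t)).
  exact: (measurable_superposition l_clamp_continuous (fun j => (lx j).1) mu_).
by apply: lbm_le mlx (lbm_growth K B lx) _ => t; exact: cost_growth.
Qed.

(** Any rate strictly between K and delta would do: it exceeds K as the
    Gronwall inequality requires, and stays below delta so that the discounted
    quantities decay. The amplification is the constant of that inequality. *)
Definition growth_rate : R := (K + delta) / 2.
Definition decay_rate : R := delta - growth_rate.
Definition amplification : R := growth_rate / (growth_rate - K).

Lemma growth_rate_gt : K < growth_rate.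
Proof. by have := K_lt_delta; rewrite /growth_rate; lra. Qed.

Lemma decay_rate_gt0 : 0 < decay_rate.
Proof. by have := K_lt_delta; rewrite /decay_rate /growth_rate; lra. Qed.

Lemma amplification_ge0 : 0 <= amplification.
Proof.
have gK := growth_rate_gt.
by rewrite divr_ge0 ?subr_ge0 ?(ltW gK)// (le_trans (ltW K_gt0))// ltW.
Qed.

Lemma growth_bound_ge0 z : 0 <= amplification * (B + K * enorm z).
Proof.
by rewrite mulr_ge0 ?amplification_ge0// addr_ge0// mulr_ge0 ?enorm_ge0// ltW.
Qed.

(** The factor exp (- delta tau), at most 1 for nonnegative tau, is dropped:
    this makes all later constants independent of the starting time. *)
Lemma discount_growth_le tau t : 0 <= tau ->
  expR (- (delta * t)) * expR (growth_rate * (t - tau)) <=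
  expR (- decay_rate * (t - tau)).
Proof.
move=> tau0; rewrite -expRD ler_expR /decay_rate.
have : 0 <= delta * tau by rewrite mulr_ge0// ltW.
lra.
Qed.

Lemma discounted_cost_le u tau z x : regular_control u -> 0 <= tau ->
  solution (controlled_field u) tau z x -> forall t, tau <= t ->
  `|discounted_cost u x t| <=
    amplification * (B + K * enorm z) * expR (- decay_rate * (t - tau)).
Proof.
move=> ru tau0 xsol t tt.
rewrite normrM ger0_norm ?expR_ge0//.
have xt := solution_growth K_gt0 (field_lipschitz ru) growth_rate_gt xsol tt.
apply: le_trans (ler_wpM2l (expR_ge0 _) (le_trans (cost_growth t _ ru) xt)) _.
rewrite mulrCA ler_wpM2l ?discount_growth_le//.
exact: growth_bound_ge0.
Qed.

Lemma integrable_discounted_cost u tau z x : regular_control u -> 0 <= tau ->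
  solution (controlled_field u) tau z x ->
  mu.-integrable `[tau, +oo[ (EFin \o discounted_cost u x).
Proof.
move=> ru tau0 xsol.
apply: (integrable_decay decay_rate_gt0 _ (discounted_cost_le ru tau0 xsol)).
exact: (lbm_discounted_cost ru xsol.1).1.
Qed.

Lemma running_costE u x tau t : 0 <= tau -> tau <= t ->
  running_cost l delta (x, u) t = discounted_cost u x t.
Proof.
move=> tau0 tt; rewrite /running_cost /discounted_cost/=.
by rewrite (max_idPr (le_trans tau0 tt)).
Qed.

Definition total_cost tau u x :=
  \int[mu]_(t in `[tau, +oo[) discounted_cost u x t.

Lemma costE u tau z x : regular_control u -> 0 <= tau ->
  solution (controlled_field u) tau z x ->
  cost l delta tau (x, u) = (total_cost tau u x)%:E.
Proof.
move=> ru tau0 xsol; rewrite /total_cost /Rintegral fineK.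
  apply: eq_integral => t; rewrite inE/= in_itv/= andbT => tt.
  by rewrite (running_costE _ _ tau0 tt).
apply: integrable_fin_num => //.
exact: (integrable_discounted_cost ru tau0 xsol).
Qed.

Lemma total_cost_le u tau z x : regular_control u -> 0 <= tau ->
  solution (controlled_field u) tau z x ->
  `|total_cost tau u x| <= amplification * (B + K * enorm z) / decay_rate.
Proof.
move=> ru tau0 xsol.
apply: (int_decay_le decay_rate_gt0 _ (discounted_cost_le ru tau0 xsol)).
exact: (lbm_discounted_cost ru xsol.1).1.
Qed.

(** A solution is even Lipschitz on segments, the right-hand side being bounded
    along it. *)
Lemma solution_loc_abs_continuous u tau z x : regular_control u ->
  solution (controlled_field u) tau z x -> loc_abs_continuous tau x.
Proof.
move=> ru xsol T tT e e0.
pose C := amplification * (B + K * enorm z) * expR (growth_rate * (T - tau)).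
have C0 : 0 <= C.
  by apply: mulr_ge0; [exact: growth_bound_ge0|exact: expR_ge0].
have C1 : 0 < C + 1 by rewrite ltr_wpDl.
exists (e / (C + 1)); first by rewrite divr_gt0.
move=> k c cP _; rewrite ltr_pdivlMr// => ce.
apply: le_lt_trans ce; rewrite mulrC mulr_sumr; apply: ler_sum => i _.
have [c1 c12 c2] := cP i.
apply: le_trans (solution_increment K_gt0 (field_lipschitz ru) growth_rate_gt
  xsol c1 c12) _.
rewrite ler_wpM2r ?subr_ge0//.
apply: (@le_trans _ _ C); last by rewrite lerDl.
rewrite ler_wpM2l ?growth_bound_ge0//.
rewrite ler_expR ler_pM2l ?lerD2r//.
exact: lt_trans growth_rate_gt.
Qed.

Lemma regular_control_lbm u : regular_control u -> lbm_vector u.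
Proof.
move=> [mu_ uO] j; split => // a b.
have [M [_ MO]] := Omega_bounded.
exists (M + 1) => s _; rewrite (le_trans (coord_le_norm _ _))//.
by apply: MO (uO s); rewrite ltrDl.
Qed.

(** The running cost of a solution is integrable because the discount beats its
    growth, and the control is locally integrable because Omega is bounded. *)
Lemma solution_process u tau z x : regular_control u -> 0 <= tau ->
  solution (controlled_field u) tau z x ->
  finite_cost_process l f Omega delta tau z (x, u).
Proof.
move=> ru tau0 xsol; have [lx xE] := xsol.
have fE s : tau <= s -> f s (x s) (u s) = controlled_field u s (x s).
  by move=> ts; rewrite /controlled_field (max_idPr (le_trans tau0 ts)).
split.
- split => /=.
  + split; last by apply: aeW => t _; exact: ru.2.
    move=> T j tT; exact: (lbm_integrable tau T (regular_control_lbm ru j)).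
  + exact: solution_loc_abs_continuous xsol.
  + move=> t j tt; split.
      have := lbm_integrable tau t (lbm_field (field_lipschitz ru) lx j).
      apply: eq_integrable => // s; rewrite inE/= in_itv/= => /andP[ts _].
      by rewrite fE.
    rewrite xE// !mxE; congr (_ + _); apply: eq_Rintegral => s.
    by rewrite inE/= in_itv/= => /andP[ts _]; rewrite fE.
- have irun : mu.-integrable `[tau, +oo[ (EFin \o running_cost l delta (x, u)).
    have := integrable_discounted_cost ru tau0 xsol.
    apply: eq_integrable => // t; rewrite inE/= in_itv/= andbT => tt.
    by rewrite (running_costE _ _ tau0 tt).
  split; last exact: integrable_add_def irun.
  by apply/measurable_EFinP; exact: measurable_int irun.
- by rewrite (costE ru tau0 xsol) ltry.
Qed.

(** The control may be redefined on a measurable null set containing the times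
    at which its value is not in Omega, and before tau, by a fixed element of
    Omega, and the trajectory may be frozen before tau: neither change affects
    the integral equation or the cost. The frozen trajectory is continuous by
    absolute continuity with a single interval. *)
Lemma process_solution (tau : R) z p : 0 <= tau ->
  finite_cost_process l f Omega delta tau z p ->
  exists u x, [/\ regular_control u, solution (controlled_field u) tau z x &
    cost l delta tau p = cost l delta tau (x, u)].
Proof.
case: p => y w tau0 [[[/= wL1 wO] yac yE] [mrun _] _].
have [v Ov] := Omega_nonempty; have [N [mN N0 wN]] := wO.
pose E : set R := `[tau, +oo[ `\` N.
pose u t := if t \in E then w t else v.
pose x (t : R) := y (Num.max tau t).
have uw t : E t -> u t = w t by move=> Et; rewrite /u mem_set.
have xy (t : R) : tau <= t -> x t = y t by move=> tt; rewrite /x (max_idPr tt).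
have mE : measurable E by apply: measurableD.
have w_meas j : measurable_fun `[tau, +oo[ (fun t => w t ord0 j).
  have -> : `[tau, +oo[%classic = \bigcup_k `[tau, tau + k%:R]%classic.
    apply/seteqP; split=> t; last first.
      by move=> [k _]; rewrite /= !in_itv/= andbT => /andP[].
    rewrite /= in_itv/= andbT => tt.
    have [k tk] : exists k, t - tau <= k%:R.
      by exists (Num.truncn (t - tau)).+1; rewrite ltW// truncnS_gt.
    by exists k => //=; rewrite in_itv/= tt -lerBlDl.
  apply/measurable_fun_bigcup => // k.
  apply/measurable_EFinP.
  by apply: measurable_int (wL1 (tau + k%:R) j _); rewrite lerDl.
have ru : regular_control u.
  split=> [j|t]; last first.
    rewrite /u; case: ifPn => // /set_mem[/=]; rewrite in_itv/= andbT => tt Nt.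
    by apply: contrapT => nO; apply: Nt; apply: wN => /= /(_ tt).
  rewrite -(setUv E); apply/measurable_funU => //; first exact: measurableC.
  split.
    apply: (@eq_measurable_fun _ _ _ _ E (fun t => w t ord0 j)).
      by move=> t /set_mem Et; rewrite uw.
    by apply: measurable_funS (w_meas j) => // t [].
  apply: (@eq_measurable_fun _ _ _ _ (~` E) (cst (v ord0 j))) => // t.
  by rewrite inE /u => nE; rewrite memNset.
have x_cont j : continuous (fun t => x t ord0 j).
  move=> t; apply/cvgrPdist_le => e e0.
  have T_ge : tau <= Num.max tau (t + 1) by rewrite le_max lexx.
  have [d d0 yd] := yac _ T_ge e e0.
  have y_close a b : tau <= a -> a <= b -> b <= Num.max tau (t + 1) ->
      b - a < d -> `|y b ord0 j - y a ord0 j| <= e.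
    move=> ta ab bT bd.
    have := yd 1%N (fun=> (a, b)); rewrite !big_ord1/= => /(_ _ _ bd) yab.
    have : enorm (y b - y a) < e.
      apply: yab => [_|]; first by split.
      by move=> i1 i2 _ _ _; rewrite !ord1.
    move=> /ltW; apply: le_trans.
    by have := coord_le_enorm (y b - y a) j; rewrite !mxE.
  near=> s.
  have sd : `|t - s| < d by near: s; apply: cvgr_dist_lt => //; exact: cvg_id.
  have s1 : s <= t + 1 by apply/ltW; near: s; apply: lt_nbhsl; rewrite ltrDl.
  have maxd := le_lt_trans (dist_max tau t s) sd.
  have maxT r : r <= t + 1 -> Num.max tau r <= Num.max tau (t + 1).
    by move=> r1; rewrite ge_max !le_max lexx r1 orbT.
  have max_ge r : tau <= Num.max tau r by rewrite le_max lexx.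
  rewrite /x; have [st|/ltW ts] := leP (Num.max tau s) (Num.max tau t).
    apply: y_close => //; first by apply: maxT; rewrite lerDl.
    exact: le_lt_trans (ler_norm _) maxd.
  rewrite distrC; apply: y_close => //; first exact: maxT.
  by rewrite distrC in maxd; exact: le_lt_trans (ler_norm _) maxd.
have lx : lbm_vector x by move=> j; exact: lbm_continuous.
have ae_E (D : set R) (P : R -> Prop) : D `<=` `[tau, +oo[ ->
    (forall t, E t -> P t) -> {ae mu, forall t, D t -> P t}.
  move=> Dtau EP; exists N; split => // t /= /not_implyP[Dt nP].
  by apply: contrapT => nN; apply/nP/EP; split=> //; exact: Dtau.
exists u, x; split => //.
- split => // t tt; apply/rowP => j; rewrite xy// (yE t j tt).2 !mxE.
  congr (_ + fine _); apply: ae_eq_integral => //.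
  + exact: measurable_int (yE t j tt).1.
  + have lf := lbm_field (field_lipschitz ru) lx j.
    exact: measurable_int (lbm_integrable tau t lf).
  + apply: ae_E => s; first by rewrite /= !in_itv/= andbT => /andP[].
    move=> Es; have [/= + _] := Es; rewrite in_itv/= andbT => ts.
    by rewrite /controlled_field uw// xy// (max_idPr (le_trans tau0 ts)).
- apply: ae_eq_integral => //.
  + exact/measurable_EFinP.
  + apply/measurable_EFinP.
    apply: (@eq_measurable_fun _ _ _ _ _ (discounted_cost u x)).
      move=> t; rewrite inE/= in_itv/= andbT => tt.
      by rewrite (running_costE _ _ tau0 tt).
    exact: measurable_funTS (lbm_discounted_cost ru lx).1.
  + apply: ae_E => // s Es; have [/= + _] := Es; rewrite in_itv/= andbT => ts.
    by rewrite /running_cost/= uw// xy.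
Unshelve. all: by end_near. Qed.

(** On [tau1, tau2] only the first solution exists and its running cost is
    bounded. At time tau2 it is a solution restarted at x1 tau2, at a distance
    from z2 of at most enorm (z1 - z2) plus the length of the path travelled
    since tau1; from there on the discount beats the separation of the two
    solutions. *)
Lemma total_cost_dist u tau1 tau2 z1 z2 x1 x2 : regular_control u ->
  0 <= tau1 -> tau1 <= tau2 ->
  solution (controlled_field u) tau1 z1 x1 ->
  solution (controlled_field u) tau2 z2 x2 ->
  `|total_cost tau1 u x1 - total_cost tau2 u x2| <=
    amplification * (B + K * enorm z1) * (tau2 - tau1) +
    K * amplification / decay_rate * (enorm (z1 - z2) +
      amplification * (B + K * enorm z1) *
      expR (growth_rate * (tau2 - tau1)) * (tau2 - tau1)).
Proof.
move=> ru tau10 t12 x1sol x2sol.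
have tau20 : 0 <= tau2 := le_trans tau10 t12.
have GP := field_lipschitz ru.
have x1sol2 := solution_restart GP t12 x1sol.
have lr1 := lbm_discounted_cost ru x1sol.1.
have lr2 := lbm_discounted_cost ru x2sol.1.
have i1 := integrable_discounted_cost ru tau10 x1sol.
have i12 := integrable_discounted_cost ru tau20 x1sol2.
have i2 := integrable_discounted_cost ru tau20 x2sol.
have -> : total_cost tau1 u x1 - total_cost tau2 u x2 =
    \int[mu]_(t in `[tau1, tau2]) discounted_cost u x1 t +
    \int[mu]_(t in `[tau2, +oo[)
      (discounted_cost u x1 t - discounted_cost u x2 t).
  rewrite RintegralB// addrA; congr (_ - _); rewrite /total_cost.
  rewrite -[X in _ + X]Rintegral_itv_obnd_cbnd; last first.
    by apply: integrableS i12 => //; apply: subset_itvr; rewrite bnd_simp.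
  by rewrite -(Rintegral_itvB i1) ?bnd_simp// addrC subrK.
rewrite (le_trans (ler_normD _ _))// lerD//.
  apply: int_abs_le_cst => // t /andP[t1 t2].
  rewrite (le_trans (discounted_cost_le ru tau10 x1sol t1))//.
  rewrite ler_piMr ?growth_bound_ge0//.
  rewrite -expR0 ler_expR mulNr oppr_le0.
  by rewrite mulr_ge0 ?(ltW decay_rate_gt0) ?subr_ge0.
have amp0 := amplification_ge0.
have step : enorm (x1 tau2 - z2) <= enorm (z1 - z2) +
    amplification * (B + K * enorm z1) *
      expR (growth_rate * (tau2 - tau1)) * (tau2 - tau1).
  rewrite -[x1 tau2](subrK z1) -addrA addrC (le_trans (enorm_triangle _ _))//.
  rewrite lerD2l.
  have [_ /(_ tau1 (lexx _))] := x1sol; rewrite vint_ge// addr0 => x1z.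
  rewrite -{1}x1z.
  exact: (solution_increment K_gt0 GP growth_rate_gt x1sol (lexx _) t12).
apply: (@le_trans _ _ (K * amplification * enorm (x1 tau2 - z2) / decay_rate)).
  apply: int_decay_le; first exact: decay_rate_gt0.
    by apply: measurable_funB; [exact: lr1.1|exact: lr2.1].
  move=> t tt; rewrite /discounted_cost -mulrBr normrM ger0_norm ?expR_ge0//.
  have x12 := solution_dist K_gt0 GP growth_rate_gt x1sol2 x2sol tt.
  have lK := lf_lipschitz (max0_ge0 t) (ru.2 t) (x1 t) (x2 t).
  apply: (@le_trans _ _ (expR (- (delta * t)) * (K * (amplification *
     enorm (x1 tau2 - z2) * expR (growth_rate * (t - tau2)))))).
    rewrite ler_wpM2l ?expR_ge0//.
    apply: (@le_trans _ _ (K * enorm (x1 t - x2 t))).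
      by apply: le_trans lK; rewrite lerDl enorm_ge0.
    by rewrite ler_wpM2l// ltW.
  rewrite [leLHS](_ : _ = K * amplification * enorm (x1 tau2 - z2) *
    (expR (- (delta * t)) * expR (growth_rate * (t - tau2)))); last by ring.
  rewrite ler_wpM2l ?discount_growth_le// mulr_ge0 ?enorm_ge0//.
  by rewrite mulr_ge0// ltW.
rewrite mulrAC ler_wpM2l//.
by rewrite divr_ge0 ?(ltW decay_rate_gt0)// mulr_ge0// ltW.
Qed.

(** * The value function *)

Local Notation value := (value_function l f Omega delta).

Lemma solution_from u tau z : regular_control u ->
  exists x, solution (controlled_field u) tau z x.
Proof. by move=> ru; exact: (solution_exists K_gt0 (field_lipschitz ru)). Qed.

Lemma value_le_total_cost u tau z x : regular_control u -> 0 <= tau ->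
  solution (controlled_field u) tau z x ->
  (value tau z <= (total_cost tau u x)%:E)%E.
Proof.
move=> ru tau0 xsol; apply: ereal_inf_lbound; exists (x, u).
  exact: solution_process.
exact: (costE ru tau0 xsol).
Qed.

Lemma le_value (c : R) tau z : 0 <= tau ->
  (forall u x, regular_control u -> solution (controlled_field u) tau z x ->
     c <= total_cost tau u x) -> (c%:E <= value tau z)%E.
Proof.
move=> tau0 cP; apply: le_ereal_inf_tmp => _ [p Dp <-].
have [u [x [ru xsol ->]]] := process_solution tau0 Dp.
by rewrite (costE ru tau0 xsol) lee_fin cP.
Qed.

Lemma value_is_well_defined tau z : 0 <= tau ->
  value_well_defined l f Omega delta tau z.
Proof.
move=> tau0; have [v Ov] := Omega_nonempty.
have rv : regular_control (cst v) by split.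
have [x xsol] := solution_from tau z rv.
split; first by exists (x, cst v); exact: solution_process.
rewrite fin_numElt; apply/andP; split; last first.
  exact: le_lt_trans (value_le_total_cost rv tau0 xsol) (ltry _).
apply: lt_le_trans (ltNyr _) (@le_value (- (amplification *
  (B + K * enorm z) / decay_rate)) tau z tau0 _) => u y ru ysol.
by have := total_cost_le ru tau0 ysol; rewrite ler_norml => /andP[].
Qed.

(** A nearly optimal control for the second initial datum also drives a
    solution from the first one. *)
Lemma value_le_value tau1 tau2 z1 z2 (e : R) : 0 <= tau1 -> 0 <= tau2 ->
  (forall u x1 x2, regular_control u ->
     solution (controlled_field u) tau1 z1 x1 ->
     solution (controlled_field u) tau2 z2 x2 ->
     total_cost tau1 u x1 <= total_cost tau2 u x2 + e) ->
  fine (value tau1 z1) <= fine (value tau2 z2) + e.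
Proof.
move=> tau10 tau20 eP.
have [_ fin1] := value_is_well_defined z1 tau10.
have [_ fin2] := value_is_well_defined z2 tau20.
rewrite -lerBlDr -lee_fin fineK//; apply: le_value => // u x2 ru x2sol.
have [x1 x1sol] := solution_from tau1 z1 ru.
rewrite lerBlDr (le_trans _ (eP _ _ _ ru x1sol x2sol))//.
by rewrite -lee_fin fineK// value_le_total_cost.
Qed.

Lemma value_dist tau1 tau2 z1 z2 : 0 <= tau1 -> tau1 <= tau2 ->
  `|fine (value tau1 z1) - fine (value tau2 z2)| <=
    amplification * (B + K * enorm z1) * (tau2 - tau1) +
    K * amplification / decay_rate * (enorm (z1 - z2) +
      amplification * (B + K * enorm z1) *
      expR (growth_rate * (tau2 - tau1)) * (tau2 - tau1)).
Proof.
move=> tau10 t12; have tau20 := le_trans tau10 t12.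
set e := (leRHS); have dist u x1 x2 : regular_control u ->
    solution (controlled_field u) tau1 z1 x1 ->
    solution (controlled_field u) tau2 z2 x2 ->
    `|total_cost tau1 u x1 - total_cost tau2 u x2| <= e.
  by move=> ru s1 s2; exact: (total_cost_dist ru tau10 t12 s1 s2).
rewrite ler_norml; apply/andP; split.
  rewrite lerNl opprB lerBlDl; apply: value_le_value => // u x2 x1 ru s2 s1.
  by have := dist u x1 x2 ru s1 s2; rewrite ler_norml => /andP[+ _]; lra.
rewrite lerBlDl; apply: value_le_value => // u x1 x2 ru s1 s2.
by have := dist u x1 x2 ru s1 s2; rewrite ler_norml => /andP[_]; lra.
Qed.

Lemma value_locally_lipschitz :
  locally_lipschitz_in [set p : R * 'rV[R]_n | 0 <= p.1]
    (fun p => fine (value p.1 p.2) : R^o).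
Proof.
move=> [tau0 z0] /= tau00.
(* On the unit ball enorm z <= enorm z0 + n, because the ball is taken in the
   sup norm, and two initial times differ by at most 2. *)
pose a := amplification * (B + K * (enorm z0 + n%:R)).
pose C := a + K * amplification / decay_rate *
  (n%:R + a * expR (growth_rate * 2)).
exists (ball (tau0, z0) 1); first exact: nbhsx_ballx.
have K0 := ltW K_gt0; have amp0 := amplification_ge0.
have dec0 := ltW decay_rate_gt0.
have grow0 : 0 < growth_rate := lt_trans K_gt0 growth_rate_gt.
have KA0 : 0 <= K * amplification / decay_rate by rewrite divr_ge0// mulr_ge0.
have a0 : 0 <= a.
  apply: le_trans (growth_bound_ge0 z0) _.
  rewrite ler_wpM2l// lerD2l ler_wpM2l//.
  by rewrite lerDl.
have main (q1 q2 : R * 'rV[R]_n) : q1.1 <= q2.1 -> 0 <= q1.1 ->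
    ball (tau0, z0) 1 q1 -> ball (tau0, z0) 1 q2 ->
    `|fine (value q1.1 q1.2) - fine (value q2.1 q2.2)| <= C * `|q1 - q2|.
  move=> t12 t1 b1 b2; apply: le_trans (value_dist _ _ t1 t12) _.
  have [bt1 bz1] : `|tau0 - q1.1| < 1 /\ `|z0 - q1.2| < 1.
    by move: b1; rewrite -ball_normE/= prod_normE gt_max => /andP[].
  have [bt2 _] : `|tau0 - q2.1| < 1 /\ `|z0 - q2.2| < 1.
    by move: b2; rewrite -ball_normE/= prod_normE gt_max => /andP[].
  have dt : q2.1 - q1.1 <= `|q1 - q2|.
    by rewrite prod_normE le_max/= distrC ler_norm.
  have dt2 : q2.1 - q1.1 <= 2.
    by move: bt1 bt2; rewrite !ltr_norml => /andP[? ?] /andP[? ?]; lra.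
  have dz : enorm (q1.2 - q2.2) <= n%:R * `|q1 - q2|.
    rewrite (le_trans (enorm_le_norm _))// ler_wpM2l//.
    by rewrite prod_normE le_max lexx orbT.
  have az : amplification * (B + K * enorm q1.2) <= a.
    rewrite ler_wpM2l// lerD2l ler_wpM2l//.
    rewrite (le_trans (enorm_leB _ z0))// lerD2l enormBC.
    by rewrite (le_trans (enorm_le_norm _))// ler_piMr// ltW.
  have dt0 : 0 <= q2.1 - q1.1 by rewrite subr_ge0.
  rewrite [leRHS]mulrDl lerD//.
    by apply: ler_pM => //; exact: growth_bound_ge0.
  rewrite -[leRHS]mulrA ler_wpM2l// mulrDl lerD//.
  apply: ler_pM => //; first by rewrite mulr_ge0 ?expR_ge0 ?growth_bound_ge0.
  apply: ler_pM => //; rewrite ?expR_ge0 ?growth_bound_ge0//.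
  by rewrite ler_expR ler_pM2l.
apply: (@klipschitzW _ _ _ C).
  apply: (@globally_properfilter _ _ ((tau0, z0), (tau0, z0))).
  by split; split => //; exact: ballxx.
move=> [q1 q2] [/= [b1 t1] [b2 t2]].
have [t12|/ltW t21] := leP q1.1 q2.1; first exact: main.
rewrite distrC; apply: le_trans (main _ _ t21 t2 b2 b1) _.
by rewrite distrC.
Qed.

End control_system.

Unset Implicit Arguments.
Set Strict Implicit.

Theorem lemma4 (R : realType) (n m : nat)
    (l : R -> 'rV[R]_n -> 'rV[R]_m -> R)
    (f : R -> 'rV[R]_n -> 'rV[R]_m -> 'rV[R]_n)
    (Omega : set 'rV[R]_m) (delta K1 K2 : R)
    (Omega_nonempty : Omega !=set0)
    (delta_gt0 : 0 < delta)
    (K1_gt0 : 0 < K1)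
    (A1 : forall (t : R) (u : 'rV[R]_m), 0 <= t -> Omega u ->
      forall x z : 'rV[R]_n,
        `|l t x u - l t z u| + enorm (f t x u - f t z u) <= K1 * enorm (x - z))
    (K2_gt0 : 0 < K2)
    (A2 : forall (t : R) (x : 'rV[R]_n) (u : 'rV[R]_m), 0 <= t -> Omega u ->
      `|l t x u| + enorm (f t x u) <= K2 * (1 + enorm x))
    (A3l : {within [set p : R * 'rV[R]_n * 'rV[R]_m | 0 <= p.1.1],
              continuous (fun p => l p.1.1 p.1.2 p.2)})
    (A3f : {within [set p : R * 'rV[R]_n * 'rV[R]_m | 0 <= p.1.1],
              continuous (fun p => f p.1.1 p.1.2 p.2)})
    (A4 : forall (t : R) (x : 'rV[R]_n), 0 <= t ->
      @convex_set R 'rV[R]_(1 + n)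
        [set row_mx (expR (- (delta * t)) * l t x v)%:M (f t x v)
          | v in Omega])
    (A5 : compact Omega)
    (A6_rate : K1 - delta < 0)
    (A6_bounded : trajectories_locally_bounded l f Omega delta) :
  (forall (tau : R) (z : 'rV[R]_n), 0 <= tau ->
     value_well_defined l f Omega delta tau z) /\
  locally_lipschitz_in [set p : R * 'rV[R]_n | 0 <= p.1]
    (fun p => fine (value_function l f Omega delta p.1 p.2) : R^o).
Proof.
have A2_at0 t u : 0 <= t -> Omega u -> `|l t 0 u| + enorm (f t 0 u) <= K2.
  by move=> t0 uO; have := A2 t 0 u t0 uO; rewrite enorm0 addr0 mulr1.
have K1_lt_delta : K1 < delta by rewrite -subr_lt0.
have Omega_bounded := compact_bounded A5.
split=> [tau z tau0|].
  exact: (value_is_well_defined K1_gt0 delta_gt0 K1_lt_delta A1 A2_at0 A3l A3f).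
exact: (value_locally_lipschitz K1_gt0 delta_gt0 K1_lt_delta A1 A2_at0 A3l A3f).
Qed.
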